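(* Let $F\subseteq[0,1]$ be a fractal set satisfying the lacunarity condition with lacunarity constant $\lambda\in(0,1]$, with complementary intervals $\{I_n\}_{n\ge1}$, and let $\mu$ be a Borel probability measure without atoms whose support is the whole of $F$. Let $a\ge 2/\lambda$ and $q\in\mathbb{R}$. Then $$\beta(q)=\inf\Big\{\beta:\ \sum_{n=1}^{\infty}\mu(\overline{I}_n^{\,a})^{q}|I_n|^{\beta}<\infty\Big\} =\inf\Big\{\beta:\ \limsup_{N\to\infty}\frac{\sum_{n=1}^{N}\mu(\overline{I}_n^{\,a})^{q}|I_n|^{\beta}}{\log N}=0\Big\}.$$
   Context: A fractal set $F$ means a compact subset of $[0,1]$ of Lebesgue measure $0$ containing the points $0$ and $1$, which is the complement in $[0,1]$ of a countable family $\{I_n\}$ of disjoint open intervals (the complementary intervals), ordered so that $|I_1|\ge|I_2|\ge\cdots>0$, where $|I|$ denotes length. $F$ satisfies the lacunarity condition with lacunarity constant $0<\lambda\le 1$ if for all $x\in F$ and $0<r\le 1$ the interval $B(x,r)$ (centred at $x$, of length $2r$) contains a complementary interval $I_n$ of length at least $\lambda r$. For a bounded interval $B$ with endpoints $s<t$ and $a\ge 0$, $\overline{B}^{\,a}=[\,s-\tfrac12 a(t-s),\ t+\tfrac12 a(t-s)\,]$ is the interval obtained by enlarging $B$ by a factor $a+1$ about its centre; $\overline{I}_n^{\,a}$ is this enlargement of $I_n$. The measure $\mu$ is regarded as a measure on $\mathbb{R}$ (giving zero mass to $\mathbb{R}\setminus F$). For $r>0$, $\mathcal{B}_r=\{[mr,(m+1)r]:m\in\mathbb{Z}\}$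 and $\mathcal{B}_r^*=\{B\in\mathcal{B}_r:\mu(B)>0\}$. The moment function $\beta(q)$ is defined by $$\beta(q)=\inf\Big\{\beta:\limsup_{r\to0}r^{\beta}\sum_{B\in\mathcal{B}_r^*}\mu(\overline{B}^{\,b})^{q}=0\Big\}=\sup\Big\{\beta:\limsup_{r\to0}r^{\beta}\sum_{B\in\mathcal{B}_r^*}\mu(\overline{B}^{\,b})^{q}=\infty\Big\},$$ where $b>0$ is an enlargement parameter; the value does not depend on the choice of $b>0$. In all infima and suprema $\beta$ ranges over $\mathbb{R}$, with values in $[-\infty,\infty]$ (so $\inf\emptyset=+\infty$). *)

(* Defs.v *)
From HB Require Import structures.
From mathcomp Require Import all_boot all_order all_algebra.
From mathcomp Require Import all_classical all_reals all_analysis.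

Set Implicit Arguments.
Unset Strict Implicit.
Unset Printing Implicit Defensive.

Import Order.TTheory GRing.Theory Num.Theory.
Import numFieldNormedType.Exports.

Local Open Scope classical_set_scope.
Local Open Scope ring_scope.

Definition fractal_set (R : realType) (F : set R) : Prop :=
  [/\ compact F, F `<=` `[0, 1], lebesgue_measure F = 0%E, F 0 & F 1].

(* The n-th complementary interval is ]s n, t n[, with n starting at 0.  The
   family is indexed by all of nat: finitely many complementary intervals would
   leave a finite F, which carries no atomless probability measure. *)
Definition complementary_intervals (R : realType) (F : set R) (s t : nat -> R) :
    Prop :=
  [/\ forall n, s n < t n,
      forall n, t n.+1 - s n.+1 <= t n - s n,
      trivIset setT (fun n => `]s n, t n[%classic) &
      `[0, 1] `\` F = \bigcup_n `]s n, t n[%classic].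

Definition lacunary (R : realType) (F : set R) (s t : nat -> R) (lam : R) :
    Prop :=
  forall x r : R, F x -> 0 < r -> r <= 1 ->
    exists n, `]s n, t n[ `<=` ball x r /\ lam * r <= t n - s n.

Definition enlarge (R : realType) (a s t : R) : set R :=
  `[s - a / 2 * (t - s), t + a / 2 * (t - s)].

(* Only open sets are tested because mu is meaningful on Borel sets only. *)
Definition msupport (R : realType) (mu : probability (measurableTypeR R) R) :
    set R :=
  [set x | forall U : set R, open U -> U x -> (0 < mu U)%E].

Definition mass_pow (R : realType) (mu : probability (measurableTypeR R) R)
    (X : set R) (q : R) : R :=
  fine (mu X) `^ q.

Definition cell (R : realType) (r : R) (m : int) : set R :=
  `[m%:~R * r, (m + 1)%:~R * r].

Definition charged_cells (R : realType)
    (mu : probability (measurableTypeR R) R) (r : R) : set int :=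
  [set m : int | (0 < mu (cell r m))%E].

Definition partition_sum (R : realType)
    (mu : probability (measurableTypeR R) R) (b q r : R) : \bar R :=
  \esum_(m in charged_cells mu r)
    (mass_pow mu (enlarge b (m%:~R * r) ((m + 1)%:~R * r)) q)%:E.

Definition scaled_limsup (R : realType)
    (mu : probability (measurableTypeR R) R) (b q beta : R) : \bar R :=
  limf_esup (fun r : R => ((r `^ beta)%:E * partition_sum mu b q r)%E) 0^'+.

Definition moment_function (R : realType)
    (mu : probability (measurableTypeR R) R) (b q : R) : \bar R :=
  ereal_inf [set beta%:E | beta in
    [set beta : R | scaled_limsup mu b q beta = 0%E]].

Lemma partition_sum_ge0 (R : realType)
    (mu : probability (measurableTypeR R) R) (b q r : R) :
  (0 <= partition_sum mu b q r)%E.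
Proof. by apply: esum_ge0 => m _; rewrite lee_fin powR_ge0. Qed.

Lemma scaled_limsup_ge0 (R : realType)
    (mu : probability (measurableTypeR R) R) (b q beta : R) :
  (0 <= scaled_limsup mu b q beta)%E.
Proof.
apply: le_ereal_inf_tmp => _ [V /= V0 <-].
have [r Vr] : V !=set0 by apply: (filter_ex V0).
apply: (@le_trans _ _ ((r `^ beta)%:E * partition_sum mu b q r)%E).
  by rewrite mule_ge0 ?lee_fin ?powR_ge0 ?partition_sum_ge0.
by apply: ereal_sup_ubound; exists r.
Qed.

Lemma scaled_limsup_shift (R : realType)
    (mu : probability (measurableTypeR R) R) (b q beta beta' : R) :
  beta < beta' -> (scaled_limsup mu b q beta < +oo)%E ->
  scaled_limsup mu b q beta' = 0%E.
Proof.
move=> bb' /ereal_inf_lt[_ [V /= V0 <-] supV].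
apply/eqP; rewrite eq_le scaled_limsup_ge0 andbT.
have [M M0 VM] : exists2 M : R, 0 < M & forall r, V r ->
    ((r `^ beta)%:E * partition_sum mu b q r <= M%:E)%E.
  have ub r : V r -> ((r `^ beta)%:E * partition_sum mu b q r <=
      ereal_sup [set ((r `^ beta)%:E * partition_sum mu b q r)%E | r in V])%E.
    by move=> Vr; apply: ereal_sup_ubound; exists r.
  case: (ereal_sup _) supV ub => [s| |] // _ ub.
    exists (Num.max s 1); first by rewrite lt_max ltr01 orbT.
    by move=> r /ub /le_trans; apply; rewrite lee_fin le_max lexx.
  by exists 1 => // r /ub /le_trans; apply; rewrite leNye.
apply/lee_addgt0Pr => e e0; rewrite add0e.
pose d := (e / M) `^ (beta' - beta)^-1.
have d0 : 0 < d by apply: powR_gt0; apply: divr_gt0.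
pose W := V `&` [set r : R | 0 < r /\ r < d].
have W0 : (0:R)^'+ W.
  apply: filterI => //; near=> r; split; first by near: r; exact: nbhs_right_gt.
  by near: r; exact: nbhs_right_lt.
apply: (@le_trans _ _ (ereal_sup
  [set ((r `^ beta')%:E * partition_sum mu b q r)%E | r in W])).
  by apply: ereal_inf_lbound; exists W.
apply: ge_ereal_sup => _ [r [Vr [r0 rd]] <-].
have -> : r `^ beta' = r `^ (beta' - beta) * r `^ beta.
  by rewrite -powRD ?subrK// (gt_eqF r0) implybT.
rewrite EFinM -muleA.
have rM : r `^ (beta' - beta) <= e / M.
  have -> : e / M = d `^ (beta' - beta).
    rewrite /d -powRrM mulVf ?powRr1 ?divr_ge0 ?ltW//.
    by rewrite subr_eq0 gt_eqF.
  by apply: ge0_ler_powR; rewrite ?nnegrE ?subr_ge0 ?ltW.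
apply: (@le_trans _ _ ((e / M)%:E * M%:E)%E); last first.
  by rewrite -EFinM divfK// gt_eqF.
apply: lee_pmul; rewrite ?lee_fin ?powR_ge0 ?VM//.
by rewrite mule_ge0 ?lee_fin ?powR_ge0 ?partition_sum_ge0.
Unshelve. all: by end_near. Qed.

Lemma moment_function_sup (R : realType)
    (mu : probability (measurableTypeR R) R) (b q : R) :
  moment_function mu b q =
  ereal_sup [set beta%:E | beta in
    [set beta : R | scaled_limsup mu b q beta = +oo%E]].
Proof.
apply/eqP; rewrite eq_le; apply/andP; split; last first.
  apply: ge_ereal_sup => _ [g /= gy <-]; apply: le_ereal_inf_tmp => _ [h /= h0 <-].
  rewrite lee_fin leNgt; apply/negP => hg.
  have := @scaled_limsup_shift _ mu b q _ _ hg.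
  by rewrite h0 gy ltry => /(_ isT).
rewrite leNgt; apply/negP => lt.
have [x [y [sx xy yi]]] : exists x y : R, [/\
    (ereal_sup [set beta%:E | beta in
      [set beta : R | scaled_limsup mu b q beta = +oo%E]] < x%:E)%E,
    x < y & (y%:E < moment_function mu b q)%E].
  move: lt; move: (ereal_sup _) (moment_function _ _ _).
  move=> [u| |] [v| |] // uv.
  - rewrite lte_fin in uv.
    exists (u + (v - u) / 3), (u + (v - u) / 3 *+ 2).
    have w0 : 0 < (v - u) / 3 by rewrite divr_gt0 ?subr_gt0.
    have vE : v = u + (v - u) / 3 *+ 3.
      by rewrite -mulr_natr divfK ?pnatr_eq0// addrC subrK.
    split; rewrite ?lte_fin ?ltrDl ?ltrD2l//.
      by rewrite mulr2n ltrDl.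
    by rewrite [ltRHS]vE ltrD2l !mulrS addr0 !mulr0n ?addr0 ltrD2l ltrDl.
  - by exists (u + 1), (u + 2); rewrite !ltry !lte_fin !ltrD2l ltrDl ltr1n.
  - exists (v - 2), (v - 1); rewrite !lte_fin !ltrD2l ltrN2 ltr1n ltNyr.
    by rewrite gtrDl oppr_lt0.
  - by exists 0, 1; rewrite ltry ltNyr.
have xfin : (scaled_limsup mu b q x < +oo)%E.
  rewrite ltey; apply/eqP => xoo.
  suff : (x%:E < x%:E)%E by rewrite ltxx.
  by apply: le_lt_trans sx; apply: ereal_sup_ubound; exists x.
have y0 := scaled_limsup_shift xy xfin.
suff : (y%:E < y%:E)%E by rewrite ltxx.
by apply: lt_le_trans yi _; apply: ereal_inf_lbound; exists y.
Qed.

(* Main.v *)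
Require Import Defs.
From mathcomp Require Import all_boot all_order all_algebra.
From mathcomp Require Import all_classical all_reals all_analysis.
From mathcomp Require Import ring lra.
Set Implicit Arguments.
Unset Strict Implicit.
Unset Printing Implicit Defensive.

Import Order.TTheory GRing.Theory Num.Theory.
Import numFieldNormedType.Exports.
Local Open Scope classical_set_scope.
Local Open Scope ring_scope.

(** Call the complementary intervals of F gaps, write l_n for the length of the
    n-th gap I_n and w_n for the q-th power of the mass of its enlargement.
    At each scale r, the partition sum S(r) over the charged cells of size r
    is comparable to the sum of the w_n over the gaps with l_n of order r.

    In one direction (cell_dominated), a charged cell meets F, and lacunarity
    provides a gap of length of order r close to it.  If q < 0, the gap is
    taken at so small a multiple of r that its enlargement lies inside the
    enlarged cell, whence the bound by anti-monotonicity of the q-th power.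
    If q >= 0, the enlarged cell is covered by boundedly many small cells, one
    of which carries a fixed proportion of the mass; a point of F in that small
    cell has a gap nearby whose enlargement swallows the small cell, because
    a >= 2 / lam (lacunary_enlarge).  The converse (gap_dominated) exchanges
    the roles: for q >= 0 a heavy cell among those covering the enlarged gap,
    for q < 0 a charged cell near an endpoint of the gap, small enough for its
    enlargement to fit in the enlarged gap.  Cells of one size, and gaps of
    comparable lengths, are uniformly separated, so each of them is used
    boundedly often (charging_sum) and the comparison of terms becomes one of sums
    (partition_sum_le_gaps, gaps_le_partition_sum).

    The three infima are then compared in a circle.  If r^beta S(r) is bounded
    and beta' > beta, summing the blocks of gaps with l_n in a dyadic range
    gives a geometric series, so that the series with exponent beta' converges
    (gap_sum_of_moment).  A convergent series has bounded partial sums, which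
    vanish after division by log N (log_average_of_summable).  Finally, if the
    partial sums are O(log N), then, as only O(1/r) gaps are longer than a
    multiple of r, r^beta S(r) = O(log (1/r)), and any increase of beta absorbs
    the logarithm (moment_shift_of_log). *)

(** * Counting separated points *)

(** Rounding (h i - x + D) / delta down to an integer is injective on L and
    lands in [0, 2 D / delta]. *)
Lemma separated_count (R : realType) (J : eqType) (h : J -> R) (delta D x : R)
    (L : seq J) :
  0 < delta -> 0 <= D -> uniq L ->
  {in L &, forall i j, i != j -> delta <= `|h i - h j|} ->
  {in L, forall i, `|x - h i| <= D} ->
  (size L)%:R <= 2 * D / delta + 1.
Proof.
move=> d0 D0 uL sepL nearL.
pose u i := (h i - x + D) / delta.
have u0 i : i \in L -> 0 <= u i.
  by move=> /nearL; rewrite ler_norml => /andP[_ xi]; apply: divr_ge0; lra.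
have uB i : i \in L -> u i <= 2 * D / delta.
  move=> /nearL; rewrite ler_norml => /andP[xi _].
  by rewrite ler_pM2r ?invr_gt0//; lra.
have injL : {in L &, injective (fun i => Num.truncn (u i))}.
  move=> i j iL jL eij; apply/eqP/negP => /negP nij.
  have := truncn_itv (u0 _ iL); have := truncn_itv (u0 _ jL).
  rewrite eij => /andP[jl jr] /andP[il ir].
  have : `|u i - u j| < 1.
    by rewrite ltr_norml; move: jr ir; rewrite -!natr1 => jr ir; apply/andP; split; lra.
  rewrite /u -mulrBl (_ : h i - x + D - _ = h i - h j); last by ring.
  rewrite normrM normfV (gtr0_norm d0) ltr_pdivrMr// mul1r ltNge.
  by rewrite sepL.
rewrite -(size_map (fun i => Num.truncn (u i))).
apply: (@le_trans _ _ (Num.truncn (2 * D / delta)).+1%:R).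
  rewrite ler_nat -(size_iota 0 (Num.truncn (2 * D / delta)).+1).
  apply: uniq_leq_size; first by rewrite map_inj_in_uniq.
  move=> _ /mapP[i iL ->]; rewrite mem_iota add0n /= ltnS.
  by apply: le_truncn; exact: uB.
by rewrite -natr1 lerD2r truncn_le divr_ge0 ?mulr_ge0// ltW.
Qed.

(** Every index i, placed at x i, hands its term f i over to some j placed at
    distance at most D; a given j receives only from the i in a window of
    radius D, and these are few because the x i are separated. *)
Lemma charging_sum (R : realType) (I J : eqType) (x f : I -> R) (y w : J -> R)
    (A : seq I) (L : seq J) (K D delta : R) :
  0 < delta -> 0 <= D -> 0 <= K -> uniq A ->
  {in A &, forall i j, i != j -> delta <= `|x i - x j|} ->
  (forall j, 0 <= w j) ->
  {in A, forall i, exists2 j, j \in L & `|y j - x i| <= D /\ f i <= K * w j} ->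
  \sum_(i <- A) f i <= K * (2 * D / delta + 1) * \sum_(j <- L) w j.
Proof.
move=> d0 D0 K0 uA sepA w0 fw.
apply: (@le_trans _ _ (\sum_(i <- A) \sum_(j <- L | `|y j - x i| <= D) K * w j)).
  rewrite big_seq [leRHS]big_seq; apply: ler_sum => i /fw[j jL [yx fK]].
  apply: (le_trans fK); rewrite (big_rem j)//= yx lerDl.
  by apply: sumr_ge0 => k _; apply: mulr_ge0.
rewrite (exchange_big_dep predT)//= mulr_sumr; apply: ler_sum => j _.
rewrite -big_filter big_const_seq count_predT iter_addr_0 -[leLHS]mulr_natr.
rewrite [leRHS]mulrAC ler_wpM2l ?mulr_ge0//.
apply: (@separated_count _ _ x _ _ (y j)) => //; first exact: filter_uniq.
  by move=> i k; rewrite !mem_filter => /andP[_ iA] /andP[_ kA]; exact: sepA.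
by move=> i; rewrite mem_filter => /andP[].
Qed.

(** * Distribution of the mass over small intervals *)
Lemma mass_le (R : realType) (mu : probability (measurableTypeR R) R)
    (X Y : set R) :
  measurable (X : set (measurableTypeR R)) ->
  measurable (Y : set (measurableTypeR R)) -> X `<=` Y ->
  fine (mu X) <= fine (mu Y).
Proof.
move=> mX mY XY; apply: fine_le; rewrite ?fin_num_measure//.
by apply: le_measure; rewrite ?inE.
Qed.

(** The interval is covered by k + 1 consecutive cells of the grid, the first
    one containing x, so one of them has at least the average mass. *)
Lemma heavy_cell (R : realType) (mu : probability (measurableTypeR R) R)
    (eta x y : R) (k : nat) :
  0 < eta -> (y - x) / eta <= k%:R ->
  exists m : int, `|m%:~R * eta - x| <= k.+1%:R * eta /\
    fine (mu `[x, y]%classic) <= k.+1%:R * fine (mu (cell eta m)).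
Proof.
move=> e0 yxk; have e1 : eta != 0 by rewrite gt_eqF.
pose m0 := Num.floor (x / eta).
have /andP[m0l m0r] := floor_itv (x / eta).
apply: contrapT => noheavy.
have light i : (i < k.+1)%N ->
    k.+1%:R * fine (mu (cell eta (m0 + i%:Z))) < fine (mu `[x, y]%classic).
  move=> ik; rewrite ltNge; apply/negP => le; apply: noheavy.
  exists (m0 + i%:Z); split=> //.
  rewrite -[in X in _ - X](divfK e1 x) -mulrBl normrM (gtr0_norm e0).
  rewrite ler_pM2r// rmorphD/= -pmulrn ler_norml.
  have i0 : 0 <= i%:R :> R by [].
  have k0 : 0 <= k%:R :> R by [].
  have : i%:R <= k%:R :> R by rewrite ler_nat -ltnS.
  move: m0r; rewrite -/m0 rmorphD/= -natr1 => m0r ik'.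
  by apply/andP; split; lra.
have cover : `[x, y]%classic `<=` \big[setU/set0]_(i < k.+1) cell eta (m0 + i%:Z).
  move=> z /=; rewrite in_itv/= => /andP[xz zy].
  have /andP[zl zr] := floor_itv (z / eta).
  have xz' : x / eta <= z / eta by rewrite ler_pM2r ?invr_gt0.
  have zy' : z / eta <= y / eta by rewrite ler_pM2r ?invr_gt0.
  have mz : m0 <= Num.floor (z / eta) by apply: le_floor.
  have [i iE] : exists i : nat, Num.floor (z / eta) = m0 + i%:Z.
    exists `|Num.floor (z / eta) - m0|%N.
    by rewrite gez0_abs ?subr_ge0// addrCA subrr addr0.
  have ik : (i < k.+1)%N.
    rewrite -(ltr_nat R) -natr1; move: zl m0r; rewrite iE -/m0 !rmorphD/= -pmulrn.
    by move: yxk; rewrite mulrBl => *; lra.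
  rewrite -(bigcup_mkord _ (fun i => cell eta (m0 + i%:Z))); exists i => //=.
  rewrite /cell/= in_itv/= -iE -(ler_pdivlMr _ _ e0) zl/=.
  by rewrite -(ler_pdivrMr _ _ e0) ltW.
have mc m : measurable (cell eta m : set (measurableTypeR R)) by exact: measurable_itv.
have : fine (mu `[x, y]%classic) <= \sum_(i < k.+1) fine (mu (cell eta (m0 + i%:Z))).
  rewrite sum_fine; last by move=> i _; exact: fin_num_measure.
  apply: fine_le.
  - exact: fin_num_measure.
  - by apply/sum_fin_numP => i _ _; exact: fin_num_measure.
  - by apply: (@content_subadditive _ _ _ mu _
      (fun i => cell eta (m0 + i%:Z))) => //; exact: measurable_itv.
apply/negP; rewrite -ltNge -(ltr_pM2l (ltr0Sn R k)) mulr_sumr.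
have -> : k.+1%:R * fine (mu `[x, y]%classic) =
    \sum_(i < k.+1) fine (mu `[x, y]%classic).
  by rewrite sumr_const card_ord mulr_natl.
apply: ltr_sum => [|i _]; last exact: light.
by apply/hasP; exists ord0; rewrite ?mem_index_enum.
Qed.

(** Each point off the support has a null open neighbourhood, but only locally:
    compactness is what turns this into a null segment. *)
Lemma charged_meets_support (R : realType)
    (mu : probability (measurableTypeR R) R) (x y : R) :
  (0 < mu `[x, y]%classic)%E -> exists2 z, msupport mu z & `[x, y]%classic z.
Proof.
move=> mu0; apply: contrapT => nosupp.
have null z : `[x, y]%classic z -> exists U : set R, [/\ open U, U z & mu U = 0%E].
  move=> xyz; apply: contrapT => noU; apply: nosupp; exists z => // U oU Uz.
  rewrite lt_neqAle measure_ge0 andbT eq_sym; apply/eqP => U0.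
  by apply: noU; exists U.
have /choice[U HU] : forall z, exists U : set R,
    `[x, y]%classic z -> [/\ open U, U z & mu U = 0%E].
  move=> z; have [/null[U HU]|nz] := pselect (`[x, y]%classic z); first by exists U.
  by exists set0.
have := @segment_compact R x y; rewrite compact_cover => cpt.
have [|z xyz|D' D'sub D'cov] := cpt _ `[x, y]%classic U.
- by move=> z /HU[].
- by exists z => //; have [] := HU z xyz.
pose L : seq R := finmap.enum_fset D'.
have : (mu `[x, y]%classic <= \sum_(k < size L) mu (U (nth x L k)))%E.
  have UD k : (k < size L)%N -> [/\ open (U (nth x L k)),
      U (nth x L k) (nth x L k) & mu (U (nth x L k)) = 0%E].
    by move=> kD; apply: HU; apply/set_mem/D'sub; exact: mem_nth.
  apply: (@content_subadditive _ _ _ mu _ (fun k => U (nth x L k))).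
  - by move=> k /UD[oU _ _]; exact: measurable_realfun.open_measurable.
  - exact: measurable_itv.
  - move=> z /D'cov[i /= iD' Uiz]; rewrite -(bigcup_mkord _ (fun k => U (nth x L k))).
    by exists (index i L) => /=; rewrite ?index_mem ?nth_index.
rewrite big1 => [|k _]; first by rewrite leNgt mu0.
by have [|] := HU (nth x L k) => //; apply/set_mem/D'sub; exact: mem_nth.
Qed.

(** * Geometry of the gaps *)

Lemma gaps_disjoint (R : realType) (F : set R) (s t : nat -> R) (m n : nat)
    (z : R) :
  complementary_intervals F s t ->
  s m < z < t m -> s n < z < t n -> m = n.
Proof.
by move=> [_ _ triv _] zm zn; apply: triv => //; exists z; split; rewrite /= in_itv.
Qed.

Lemma gap_notin (R : realType) (F : set R) (s t : nat -> R) (n : nat) (z : R) :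
  complementary_intervals F s t -> s n < z < t n -> ~ F z /\ 0 <= z <= 1.
Proof.
move=> [_ _ _ compl] zn.
have : (`[0, 1] `\` F) z by rewrite compl; exists n; rewrite //= in_itv.
by move=> [/= z01 nF]; split=> //; move: z01; rewrite in_itv.
Qed.

Lemma gap_bounds (R : realType) (F : set R) (s t : nat -> R) (n : nat)
    (x y : R) :
  complementary_intervals F s t -> `]s n, t n[ `<=` `[x, y]%classic ->
  x <= s n /\ t n <= y.
Proof.
move=> [/(_ n) st _ _ _] sub; split; rewrite leNgt; apply/negP => out.
- have := sub ((s n + Num.min (t n) x) / 2); rewrite /= !in_itv/=.
  by case: (lerP (t n) x) => ? /(_ ltac:(apply/andP; split; lra)) /andP[]; lra.
- have := sub ((t n + Num.max (s n) y) / 2); rewrite /= !in_itv/=.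
  by case: (lerP (s n) y) => ? /(_ ltac:(apply/andP; split; lra)) /andP[]; lra.
Qed.

Lemma gap_unit (R : realType) (F : set R) (s t : nat -> R) (n : nat) :
  complementary_intervals F s t -> 0 <= s n /\ t n <= 1.
Proof.
move=> hI; apply: (@gap_bounds _ _ _ _ _ 0 1 hI) => z /=; rewrite !in_itv/= => zn.
by have [] := gap_notin hI zn.
Qed.

(** Otherwise s n would lie inside another gap, which would then overlap the
    n-th one. *)
Lemma gap_left_in (R : realType) (F : set R) (s t : nat -> R) (n : nat) :
  complementary_intervals F s t -> F (s n).
Proof.
move=> hI; apply: contrapT => nF.
have [s0 t1] := gap_unit n hI; have [/(_ n) st _ _ compl] := hI.
have : (`[0, 1] `\` F) (s n).
  by split=> //=; rewrite in_itv/= s0/=; lra.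
rewrite compl => -[m _ /=]; rewrite in_itv/= => /andP[sm tm].
have : m = n.
  apply: (@gaps_disjoint _ _ _ _ _ _ ((s n + Num.min (t n) (t m)) / 2) hI).
    by case: (lerP (t n) (t m)) => ?; apply/andP; split; lra.
  by case: (lerP (t n) (t m)) => ?; apply/andP; split; lra.
by move=> mn; move: sm; rewrite mn ltxx.
Qed.

Lemma gaps_separated (R : realType) (F : set R) (s t : nat -> R) (m n : nat)
    (delta : R) :
  complementary_intervals F s t -> m != n ->
  delta <= t m - s m -> delta <= t n - s n -> delta <= `|s m - s n|.
Proof.
move=> hI; wlog smn : m n / s m <= s n.
  move=> wl mn dm dn; case: (leP (s m) (s n)) => [|/ltW] le; first exact: wl.
  by rewrite distrC; apply: wl; rewrite // eq_sym.
move=> mn dm dn; have [st _ _ _] := hI; have := st m; have := st n => stn stm.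
have [tms|stm'] := leP (t m) (s n).
  by rewrite distrC ger0_norm; lra.
have : m = n.
  apply: (@gaps_disjoint _ _ _ _ _ _ ((s n + Num.min (t n) (t m)) / 2) hI).
    by case: (lerP (t n) (t m)) => ?; apply/andP; split; lra.
  by case: (lerP (t n) (t m)) => ?; apply/andP; split; lra.
by move=> /eqP; rewrite (negbTE mn).
Qed.

Lemma gaps_nonincreasing (R : realType) (F : set R) (s t : nat -> R) (i j : nat) :
  complementary_intervals F s t -> (i <= j)%N -> t j - s j <= t i - s i.
Proof.
move=> [_ dec _ _]; elim: j => [|j IH]; first by rewrite leqn0 => /eqP ->.
rewrite leq_eqVlt => /orP[/eqP ->//|]; rewrite ltnS => /IH; exact: le_trans.
Qed.

(** The left endpoints of the first n + 1 gaps lie in [0, 1] and are separated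
    by the length of the n-th gap, the shortest of them. *)
Lemma gap_index_bound (R : realType) (F : set R) (s t : nat -> R) (n : nat) :
  complementary_intervals F s t -> n%:R <= 2 / (t n - s n).
Proof.
move=> hI; have [st _ _ _] := hI.
have l0 : 0 < t n - s n by rewrite subr_gt0.
have := @separated_count R nat s (t n - s n) 1 0 (iota 0 n.+1) l0 ler01 (iota_uniq _ _).
rewrite size_iota -natr1 mulr1 lerD2r; apply.
  move=> i j; rewrite !mem_iota !add0n !ltnS => /andP[_ ni] /andP[_ nj] ij.
  by apply: (gaps_separated hI) => //; exact: gaps_nonincreasing hI _.
move=> i _; have [s0 t1] := gap_unit i hI; have := st i.
by rewrite sub0r normrN ger0_norm//; lra.
Qed.

(** The gap has length at least lam * rho and a >= 2 / lam, so the enlargement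
    adds at least rho on either side.  As y is not in the gap but within rho of
    it, the enlargement reaches y and goes past it by the length of the gap. *)
Lemma lacunary_enlarge (R : realType) (F : set R) (s t : nat -> R)
    (lam a y rho : R) :
  complementary_intervals F s t -> lacunary F s t lam -> 0 < lam ->
  2 / lam <= a -> F y -> 0 < rho -> rho <= 1 ->
  exists n, [/\ lam * rho <= t n - s n, t n - s n <= 2 * rho,
    `|y - s n| <= rho,
    `[y - lam * rho, y + lam * rho] `<=` enlarge a (s n) (t n) &
    enlarge a (s n) (t n) `<=` `[y - (1 + a) * rho, y + (1 + a) * rho]%classic].
Proof.
move=> hI hlac lam0 a_ge Fy rho0 rho1.
have [n [sub len]] := hlac y rho Fy rho0 rho1.
have [/(_ n) st _ _ _] := hI.
have [lo hi] : y - rho <= s n /\ t n <= y + rho.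
  apply: (@gap_bounds _ _ _ _ _ _ _ hI) => z /sub.
  rewrite /ball/= in_itv/= ltr_norml => /andP[? ?].
  by apply/andP; split; lra.
have out : y <= s n \/ t n <= y.
  have [|ys] := leP y (s n); first by left.
  have [|yt] := leP (t n) y; first by right.
  have zn : s n < y < t n by rewrite ys yt.
  by have [] := gap_notin hI zn.
have a2 : 2 <= a * lam by rewrite -ler_pdivrMr.
have a0 : 0 < a by apply: lt_le_trans a_ge; rewrite divr_gt0.
have big : rho <= a / 2 * (t n - s n).
  have : a / 2 * (lam * rho) <= a / 2 * (t n - s n) by rewrite ler_pM2l// divr_gt0.
  have : 2 * rho <= a * lam * rho by rewrite ler_pM2r.
  by lra.
have small : a / 2 * (t n - s n) <= a * rho.
  have : a * (t n - s n) <= a * (2 * rho) by rewrite ler_pM2l//; lra.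
  by lra.
exists n; split=> //; first by lra.
- by rewrite ler_norml; apply/andP; split; lra.
- move=> z; rewrite /enlarge/= !in_itv/= => /andP[? ?].
  by apply/andP; split; case: out => ?; lra.
- by move=> z; rewrite /enlarge/= !in_itv/= => /andP[? ?]; apply/andP; split; lra.
Qed.

(** * Comparing the masses of cells and of gaps *)

Lemma fine_mass_gt0 (R : realType) (mu : probability (measurableTypeR R) R)
    (x y : R) :
  (0 < mu `[x, y]%classic)%E = (0 < fine (mu `[x, y]%classic)).
Proof.
have fin : mu `[x, y]%classic \is a fin_num.
  by apply: fin_num_measure; exact: measurable_itv.
by rewrite -lte_fin fineK.
Qed.

Lemma support_mass_gt0 (R : realType) (mu : probability (measurableTypeR R) R)
    (x y z : R) :
  msupport mu z -> x < z < y -> 0 < fine (mu `[x, y]%classic).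
Proof.
move=> supp xzy; rewrite -fine_mass_gt0.
have : (0 < mu `]x, y[%classic)%E.
  by apply: supp; [exact: interval_open | rewrite /= in_itv].
move=> /lt_le_trans; apply; apply: le_measure; rewrite ?inE.
- exact: measurable_itv.
- exact: measurable_itv.
- exact: subset_itv_oo_cc.
Qed.

Lemma mass_pow_scale (R : realType) (mu : probability (measurableTypeR R) R)
    (X Y : set R) (c q : R) :
  0 <= q -> 0 <= c -> fine (mu X) <= c * fine (mu Y) ->
  mass_pow mu X q <= c `^ q * mass_pow mu Y q.
Proof.
move=> q0 c0 XY; rewrite /mass_pow -powRM ?fine_ge0 ?measure_ge0//.
by apply: ge0_ler_powR; rewrite ?nnegrE ?mulr_ge0 ?fine_ge0 ?measure_ge0.
Qed.

Lemma mass_pow_anti (R : realType) (mu : probability (measurableTypeR R) R)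
    (X Y : set R) (q : R) :
  q <= 0 -> 0 < fine (mu Y) -> fine (mu Y) <= fine (mu X) ->
  mass_pow mu X q <= mass_pow mu Y q.
Proof.
move=> q0 Y0 YX; have X0 := lt_le_trans Y0 YX.
rewrite /mass_pow -(opprK q) powRN [leRHS]powRN lef_pV2 ?posrE ?powR_gt0//.
by apply: ge0_ler_powR; rewrite ?nnegrE ?oppr_ge0// ltW.
Qed.

Lemma gap_mass_gt0 (R : realType) (F : set R) (s t : nat -> R) (a : R)
    (mu : probability (measurableTypeR R) R) (n : nat) :
  complementary_intervals F s t -> msupport mu = F -> 0 < a ->
  0 < fine (mu (enlarge a (s n) (t n))).
Proof.
move=> hI supp a0; apply: (@support_mass_gt0 _ _ _ _ (s n)).
  by rewrite supp; exact: gap_left_in hI.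
have [/(_ n) st _ _ _] := hI.
have : 0 < a / 2 * (t n - s n) by rewrite mulr_gt0 ?divr_gt0 ?subr_gt0.
by move=> ?; apply/andP; split; lra.
Qed.

Lemma cell_enlarge (R : realType) (b r : R) (m : int) :
  0 <= b -> 0 <= r ->
  cell r m `<=` enlarge b (m%:~R * r) ((m + 1)%:~R * r).
Proof.
move=> b0 r0; have br : 0 <= b * r by exact: mulr_ge0.
move=> z; rewrite /cell /enlarge/= !in_itv/= intrD mulr1z => /andP[? ?].
by apply/andP; split; lra.
Qed.

(** The two signs of q need different gaps.  For q >= 0 the enlarged gap has to
    contain a part of the enlarged cell with a fixed proportion of its mass;
    for q < 0 it has to be contained in the enlarged cell.  In both cases the
    gap is of length of order r and within a multiple of r of the cell, which
    is what the counting of charges requires. *)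
Lemma cell_dominated (R : realType) (F : set R) (s t : nat -> R) (lam : R)
    (mu : probability (measurableTypeR R) R) (a b q : R) :
  complementary_intervals F s t -> 0 < lam -> lam <= 1 -> lacunary F s t lam ->
  msupport mu = F -> 2 / lam <= a -> 0 < b ->
  exists K D c1 c2 r0 : R,
    [/\ 0 <= K, 0 <= D, 0 < c1, 0 < c2 & 0 < r0] /\
    forall (r : R) (m : int), 0 < r -> r <= r0 -> charged_cells mu r m ->
    exists n, [/\ c1 * r <= t n - s n, t n - s n <= c2 * r,
      `|s n - m%:~R * r| <= D * r &
      mass_pow mu (enlarge b (m%:~R * r) ((m + 1)%:~R * r)) q <=
        K * mass_pow mu (enlarge a (s n) (t n)) q].
Proof.
move=> hI lam0 lam1 hlac supp a_ge b0.
have a0 : 0 < a by apply: lt_le_trans a_ge; rewrite divr_gt0.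
have mcell r m : measurable (cell r m : set (measurableTypeR R)).
  exact: measurable_itv.
have menl c x y : measurable (enlarge c x y : set (measurableTypeR R)).
  exact: measurable_itv.
have [q0|q0] := leP 0 q.
- have bl0 : 0 <= (1 + b) / lam by rewrite divr_ge0//; lra.
  have := archi_boundP bl0; set k := Num.bound _ => /ltW kP.
  exists (k.+1%:R `^ q), (b / 2 + k.+1%:R + 2), lam, 2, 1; split.
    by split; rewrite ?powR_ge0 ?addr_ge0 ?divr_ge0// ltW.
  move=> r m r0 r1 charged.
  have e0 : 0 < lam * r by exact: mulr_gt0.
  have lr : lam * r <= r by rewrite ger_pMl.
  pose x0 := m%:~R * r - b / 2 * ((m + 1)%:~R * r - m%:~R * r).
  pose y0 := (m + 1)%:~R * r + b / 2 * ((m + 1)%:~R * r - m%:~R * r).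
  have klen : (y0 - x0) / (lam * r) <= k%:R.
    rewrite (_ : (y0 - x0) / (lam * r) = (1 + b) / lam)//.
    by rewrite /x0 /y0 intrD mulr1z; field; rewrite !gt_eqF.
  (* An enlarged gap found within r of a point contains the interval of radius
     lam * r about it, hence any cell of that size through the point. *)
  have [j [jx jmass]] := heavy_cell mu e0 klen.
  have B0 : 0 < fine (mu (enlarge b (m%:~R * r) ((m + 1)%:~R * r))).
    apply: (@lt_le_trans _ _ (fine (mu (cell r m)))).
      by rewrite -fine_mass_gt0.
    by apply: mass_le => //; apply: cell_enlarge; exact: ltW.
  have J0 : (0 < mu (cell (lam * r) j))%E.
    rewrite fine_mass_gt0 -(pmulr_rgt0 _ (ltr0Sn R k)).
    exact: lt_le_trans B0 jmass.
  have [y suppy jy] := charged_meets_support J0.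
  rewrite supp in suppy.
  have [n [n1 n2 yn Jn _]] := lacunary_enlarge hI hlac lam0 a_ge suppy r0 r1.
  move: jy; rewrite /= in_itv/= intrD mulr1z => /andP[jy1 jy2].
  exists n; split=> //.
  + have kr : k.+1%:R * (lam * r) <= k.+1%:R * r by rewrite ler_pM2l.
    have br0 : 0 < b * r by exact: mulr_gt0.
    move: jx yn; rewrite /x0 intrD mulr1z !ler_norml => /andP[? ?] /andP[? ?].
    by apply/andP; split; lra.
  + apply: mass_pow_scale => //; apply: (le_trans jmass).
    rewrite ler_pM2l//; apply: mass_le => // z.
    rewrite /cell/= in_itv/= intrD mulr1z => /andP[? ?].
    by apply: Jn; rewrite /= in_itv/=; apply/andP; split; lra.
(* An enlarged gap found within rho of a point stays within (1 + a) * rho of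
   it; with rho = c * r this is b * r / 2, the margin of the enlarged cell. *)
- pose c := b / (2 * (1 + a)).
  have c0 : 0 < c by rewrite divr_gt0// mulr_gt0// ltr_wpDl.
  have cE : (1 + a) * c = b / 2 by rewrite /c; field; rewrite gt_eqF//; lra.
  exists 1, (1 + c), (lam * c), (2 * c), c^-1; split.
    by split; rewrite ?mulr_gt0 ?invr_gt0//; lra.
  move=> r m r0 r1 charged.
  have [y suppy my] := charged_meets_support charged.
  rewrite supp in suppy.
  have cr0 : 0 < c * r by exact: mulr_gt0.
  have cr1 : c * r <= 1 by rewrite mulrC -ler_pdivlMr// mul1r.
  have [n [n1 n2 yn _ nB]] := lacunary_enlarge hI hlac lam0 a_ge suppy cr0 cr1.
  move: my; rewrite /= in_itv/= intrD mulr1z => /andP[my1 my2].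
  exists n; split; rewrite -?(mulrA lam c r) -?(mulrA 2 c r)//.
    by move: yn; rewrite !ler_norml => /andP[? ?]; apply/andP; split; lra.
  rewrite mul1r; apply: mass_pow_anti.
  + exact: ltW.
  + exact: gap_mass_gt0 hI supp a0.
  + apply: mass_le => //; apply: (subset_trans nB) => z.
    rewrite mulrA cE /enlarge/= !in_itv/= => /andP[? ?].
    by apply/andP; split; lra.
Qed.

(** The size c * r of the cells is allowed to depend on the sign of q: for
    q >= 0 the size r will do, while for q < 0 the enlarged cell must fit inside
    the enlarged gap, which forces small cells. *)
Lemma gap_dominated (R : realType) (F : set R) (s t : nat -> R)
    (mu : probability (measurableTypeR R) R) (a b q : R) :
  complementary_intervals F s t -> msupport mu = F -> 0 < a -> 0 < b ->
  exists K D c : R, [/\ 0 <= K, 0 <= D & 0 < c] /\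
    forall (r : R) (n : nat), 0 < r -> r / 2 < t n - s n <= r ->
    exists m, [/\ charged_cells mu (c * r) m,
      `|m%:~R * (c * r) - s n| <= D * r &
      mass_pow mu (enlarge a (s n) (t n)) q <=
        K * mass_pow mu
          (enlarge b (m%:~R * (c * r)) ((m + 1)%:~R * (c * r))) q].
Proof.
move=> hI supp a0 b0.
have mcell r m : measurable (cell r m : set (measurableTypeR R)).
  exact: measurable_itv.
have menl c x y : measurable (enlarge c x y : set (measurableTypeR R)).
  exact: measurable_itv.
have [q0|q0] := leP 0 q.
- have a10 : 0 <= 1 + a by lra.
  have := archi_boundP a10; set k := Num.bound _ => /ltW kP.
  exists (k.+1%:R `^ q), (a / 2 + k.+1%:R), 1; split.
    by split; rewrite ?powR_ge0 ?addr_ge0 ?divr_ge0// ltW.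
  move=> r n r0 /andP[rl lr]; rewrite mul1r.
  have alr : a * (t n - s n) <= a * r by rewrite ler_pM2l.
  have al0 : 0 < a * (t n - s n) by rewrite mulr_gt0//; lra.
  pose x0 := s n - a / 2 * (t n - s n).
  pose y0 := t n + a / 2 * (t n - s n).
  have klen : (y0 - x0) / r <= k%:R.
    by apply: le_trans kP; rewrite ler_pdivrMr// /x0 /y0; lra.
  have [m [mx mmass]] := heavy_cell mu r0 klen.
  exists m; split.
  + rewrite /charged_cells/= fine_mass_gt0 -(pmulr_rgt0 _ (ltr0Sn R k)).
    exact: lt_le_trans (gap_mass_gt0 n hI supp a0) mmass.
  + move: mx; rewrite /x0 !ler_norml => /andP[? ?].
    by apply/andP; split; lra.
  + apply: mass_pow_scale => //; apply: (le_trans mmass).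
    rewrite ler_pM2l//; apply: mass_le => //.
    by apply: cell_enlarge; exact: ltW.
(* The cell found below starts within 4 * (c * r) of s n, so its enlargement
   stays within (4 + b) * (c * r) = a * r / 4 of s n, and the gap has a margin
   of a / 2 times its length, which is at least r / 2. *)
- pose c := a / (4 * (4 + b)).
  have c0 : 0 < c by rewrite divr_gt0// mulr_gt0// ltr_wpDl.
  have cE : (4 + b) * c = a / 4 by rewrite /c; field; rewrite gt_eqF//; lra.
  exists 1, (4 * c), c; split; first by split; lra.
  move=> r n r0 /andP[rl lr].
  have e0 : 0 < c * r by exact: mulr_gt0.
  have klen : ((s n + c * r) - (s n - c * r)) / (c * r) <= 2%:R.
    by rewrite ler_pdivrMr//; lra.
  have [m [mx mmass]] := heavy_cell mu e0 klen.
  have S0 : 0 < fine (mu `[s n - c * r, s n + c * r]%classic).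
    apply: (@support_mass_gt0 _ _ _ _ (s n)); first by rewrite supp; exact: gap_left_in hI.
    by apply/andP; split; lra.
  have M0 : 0 < fine (mu (cell (c * r) m)).
    by rewrite -(pmulr_rgt0 _ (ltr0Sn R 2)); exact: lt_le_trans S0 mmass.
  move: mx; rewrite !ler_norml => /andP[mx1 mx2].
  exists m; split.
  + by rewrite /charged_cells/= fine_mass_gt0.
  + by rewrite ler_norml; apply/andP; split; lra.
  + rewrite mul1r; apply: mass_pow_anti; first exact: ltW.
      apply: (lt_le_trans M0); apply: mass_le => //.
      by apply: cell_enlarge; exact: ltW.
    apply: mass_le => // z.
    have ber : (4 + b) * (c * r) = a / 4 * r by rewrite mulrA cE.
    have alr : a * (r / 2) <= a * (t n - s n) by rewrite ler_pM2l//; lra.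
    have bcr : 0 < b * (c * r) by exact: mulr_gt0.
    rewrite /enlarge/= !in_itv/= intrD mulr1z => /andP[? ?].
    by apply/andP; split; lra.
Qed.

(** * Comparing the sums over cells and over gaps at one scale *)

Lemma multiples_separated (R : realType) (r : R) (m k : int) :
  0 < r -> m != k -> r <= `|m%:~R * r - k%:~R * r|.
Proof.
move=> r0 mk; rewrite -mulrBl normrM (gtr0_norm r0); apply: ler_peMl; first exact: ltW.
rewrite -intrB -intr_norm -[1]/(1%:~R) ler_int.
by rewrite -gtz0_ge1 normr_gt0 subr_eq0.
Qed.

(** The bound N on the indices of the gaps longer than c1 * r makes the right
    side a finite sum, to be compared later with a partial sum of the series
    over all gaps. *)
Lemma partition_sum_le_gaps (R : realType) (F : set R) (s t : nat -> R)
    (lam : R) (mu : probability (measurableTypeR R) R) (a b q : R) :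
  complementary_intervals F s t -> 0 < lam -> lam <= 1 -> lacunary F s t lam ->
  msupport mu = F -> 2 / lam <= a -> 0 < b ->
  exists C c1 c2 r0 : R, [/\ 0 <= C, 0 < c1, 0 < c2 & 0 < r0] /\
    forall (r : R) (N : nat), 0 < r -> r <= r0 ->
    (forall n, c1 * r <= t n - s n -> (n < N)%N) ->
    (partition_sum mu b q r <=
      (C * \sum_(0 <= n < N | c1 * r <= t n - s n <= c2 * r)
        mass_pow mu (enlarge a (s n) (t n)) q)%:E)%E.
Proof.
move=> hI lam0 lam1 hlac supp a_ge b0.
have [K [D [c1 [c2 [r0 [[K0 D0 c10 c20 r00] dom]]]]]] :=
  cell_dominated q hI lam0 lam1 hlac supp a_ge b0.
exists (K * (2 * D + 1)), c1, c2, r0; split.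
  by split=> //; rewrite mulr_ge0// addr_ge0// mulr_ge0.
move=> r N rpos rr0 short; apply: ge_ereal_sup => _ [A [finA sub] <-].
rewrite fsbig_finite// sumEFin lee_fin -[in leRHS]big_filter.
have -> : 2 * D + 1 = 2 * (D * r) / r + 1 by field; rewrite gt_eqF.
apply: (@charging_sum _ _ _ (fun m : int => m%:~R * r) _ s) => //.
- by rewrite mulr_ge0// ltW.
- exact: finmap.fset_uniq.
- by move=> m k _ _; exact: multiples_separated.
- by move=> n; exact: powR_ge0.
- move=> m; rewrite in_fset_set// inE => /sub charged.
  have [n [n1 n2 near le]] := dom r m rpos rr0 charged.
  by exists n; rewrite ?mem_filter ?n1 ?n2 ?mem_index_iota ?short.
Qed.

Lemma gaps_le_partition_sum (R : realType) (F : set R) (s t : nat -> R)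
    (mu : probability (measurableTypeR R) R) (a b q : R) :
  complementary_intervals F s t -> msupport mu = F -> 0 < a -> 0 < b ->
  exists C c : R, [/\ 0 <= C & 0 < c] /\
    forall (r : R) (N : nat), 0 < r ->
    ((\sum_(0 <= n < N | r / 2 < t n - s n <= r)
        mass_pow mu (enlarge a (s n) (t n)) q)%:E <=
      C%:E * partition_sum mu b q (c * r))%E.
Proof.
move=> hI supp a0 b0.
have [K [D [c [[K0 D0 c0] dom]]]] := gap_dominated q hI supp a0 b0.
exists (K * (4 * D + 1)), c; split.
  by split=> //; rewrite mulr_ge0// addr_ge0// mulr_ge0.
move=> r N r0; rewrite -big_filter; set A := [seq _ <- _ | _].
have /choice[g Hg] : forall n, exists m, r / 2 < t n - s n <= r ->
    [/\ charged_cells mu (c * r) m,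
      `|m%:~R * (c * r) - s n| <= D * r &
      mass_pow mu (enlarge a (s n) (t n)) q <=
        K * mass_pow mu
          (enlarge b (m%:~R * (c * r)) ((m + 1)%:~R * (c * r))) q].
  move=> n; case: (boolP (r / 2 < t n - s n <= r)) => [/(dom r n r0)[m Hm]|_].
    by exists m.
  by exists 0.
pose f m := mass_pow mu (enlarge b (m%:~R * (c * r)) ((m + 1)%:~R * (c * r))) q.
(* The sum over all charged cells bounds the sum over the finitely many
   cells that are used. *)
pose L := undup [seq g n | n <- A].
have gapA n : n \in A -> r / 2 < t n - s n <= r.
  by rewrite mem_filter => /andP[].
have le : \sum_(n <- A) mass_pow mu (enlarge a (s n) (t n)) q <=
    K * (2 * (D * r) / (r / 2) + 1) * \sum_(m <- L) f m.
  apply: (@charging_sum _ _ _ s _ (fun m : int => m%:~R * (c * r))) => //.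
  - by rewrite divr_gt0.
  - by rewrite mulr_ge0// ltW.
  - by rewrite filter_uniq// iota_uniq.
  - move=> i j /gapA/andP[iA _] /gapA/andP[jA _] ij.
    by apply: (gaps_separated hI) => //; exact: ltW.
  - by move=> m; exact: powR_ge0.
  - move=> n nA; have [_ near dommass] := Hg n (gapA _ nA).
    by exists (g n) => //; rewrite mem_undup map_f.
have -> : 4 * D + 1 = 2 * (D * r) / (r / 2) + 1 by field; rewrite gt_eqF.
apply: (@le_trans _ _ ((K * (2 * (D * r) / (r / 2) + 1))%:E *
    (\sum_(m <- L) f m)%:E)%E); first by rewrite -EFinM lee_fin.
apply: lee_wpmul2l.
  rewrite lee_fin mulr_ge0// addr_ge0// divr_ge0 ?mulr_ge0//; lra.
apply: esum_ge; exists [set` L]; last first.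
  by rewrite -fsbig_seq ?undup_uniq// sumEFin.
split; first exact: finite_seq.
by move=> m /=; rewrite mem_undup => /mapP[n /gapA/Hg[ch _ _] ->].
Qed.

(** * Upper limits, exponents and powers *)

Lemma limf_esup_le (R : realType) (T : choiceType) (X : filteredType T)
    (f : X -> \bar R) (H : set_system X) (M : \bar R) :
  (\forall x \near H, (f x <= M)%E) -> (limf_esup f H <= M)%E.
Proof.
move=> nearM; apply: (@le_trans _ _
  (ereal_sup [set f x | x in [set x | (f x <= M)%E]])).
  by apply: ereal_inf_lbound; exists [set x | (f x <= M)%E].
by apply: ge_ereal_sup => _ [x /= fx <-].
Qed.

Lemma limf_esup_lt (R : realType) (T : choiceType) (X : filteredType T)
    (f : X -> \bar R) (H : set_system X) (M : \bar R) :
  Filter H -> (limf_esup f H < M)%E -> \forall x \near H, (f x <= M)%E.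
Proof.
move=> filterH /ereal_inf_lt[_ [V /= HV <-] supV].
apply: filterS HV => x Vx; apply: le_trans (ltW supV).
by apply: ereal_sup_ubound; exists x.
Qed.

Lemma near_right0P (R : realType) (P : R -> Prop) :
  (\forall r \near 0^'+, P r) ->
  exists2 d : R, 0 < d & forall r, 0 < r -> r < d -> P r.
Proof.
rewrite /at_right near_withinE => /nbhs_ballP[d /= d0 sub].
exists d => // r r0 rd; apply: (sub r) => //.
by rewrite /ball/= sub0r normrN gtr0_norm.
Qed.

(** Sets of exponents need only be compared up to an arbitrarily small increase
    of the exponent, which is the form in which the estimates come. *)
Lemma ereal_inf_le_shift (R : realType) (A B : set R) :
  (forall x y, A x -> x < y -> B y) ->
  (ereal_inf [set x%:E | x in B] <= ereal_inf [set x%:E | x in A])%E.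
Proof.
move=> AB; apply: le_ereal_inf_tmp => _ [x /= Ax <-].
apply/lee_addgt0Pr => e e0; apply: ereal_inf_lbound; exists (x + e) => //=.
by apply: AB Ax _; rewrite ltrDl.
Qed.

(** One of the two terms of the constant suffices, which one depending on the
    sign of p; the sum covers both. *)
Lemma powR_comparable (R : realType) (c1 c2 r x p : R) :
  0 < c1 -> 0 < r -> c1 * r <= x -> x <= c2 * r ->
  r `^ p <= (c1 `^ (- p) + c2 `^ (- p)) * x `^ p.
Proof.
move=> c10 r0 lo hi.
pose u := x / r; have c1u : c1 <= u by rewrite ler_pdivlMr.
have uc2 : u <= c2 by rewrite ler_pdivrMr.
have u0 : 0 < u := lt_le_trans c10 c1u.
have c20 : 0 < c2 := lt_le_trans u0 uc2.
have -> : x = u * r by rewrite divfK// gt_eqF.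
rewrite (powRM _ (ltW u0) (ltW r0)) mulrA ler_peMl ?powR_ge0//.
have -> : 1 = u `^ (- p) * u `^ p by rewrite powRN mulVf// powR_eq0 gt_eqF.
rewrite ler_wpM2r ?powR_ge0//.
have [p0|/ltW p0] := leP 0 p.
  rewrite -[leLHS]addr0 lerD ?powR_ge0// !powRN lef_pV2 ?posrE ?powR_gt0//.
  by apply: ge0_ler_powR; rewrite ?nnegrE// ltW.
rewrite -[leLHS]add0r lerD ?powR_ge0//.
by apply: ge0_ler_powR; rewrite ?nnegrE ?oppr_ge0// ltW.
Qed.

Lemma ln_le_powR (R : realType) (x e : R) :
  0 < x -> 0 < e -> ln x <= x `^ e / e.
Proof.
move=> x0 e0; rewrite ler_pdivlMr// mulrC -ln_powR.
by apply/ltW/ln_sublinear; exact: powR_gt0.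
Qed.

(** * Comparing the exponents *)

(** Write e for half of beta' - beta.  By partition_sum_le_gaps, r^beta S(r) is
    at most a constant times ln N, where N is of order 1 / r, and r^e ln N is
    bounded; so the upper limit is finite at beta + e < beta', hence zero at
    beta'. *)
Lemma moment_shift_of_log (R : realType) (F : set R) (s t : nat -> R)
    (lam : R) (mu : probability (measurableTypeR R) R) (a b q beta beta' : R) :
  complementary_intervals F s t -> 0 < lam -> lam <= 1 -> lacunary F s t lam ->
  msupport mu = F -> 2 / lam <= a -> 0 < b -> beta < beta' ->
  limn_esup (fun N : nat =>
    ((\sum_(0 <= n < N)
        mass_pow mu (enlarge a (s n) (t n)) q * (t n - s n) `^ beta)
     / ln N%:R)%:E) = 0%E ->
  scaled_limsup mu b q beta' = 0%E.
Proof.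
move=> hI lam0 lam1 hlac supp a_ge b0 bb' log0.
pose w n := mass_pow mu (enlarge a (s n) (t n)) q.
have w0 n : 0 <= w n by exact: powR_ge0.
have [C [c1 [c2 [r0 [[C0 c10 c20 r00] SC]]]]] :=
  partition_sum_le_gaps q hI lam0 lam1 hlac supp a_ge b0.
have [N0 _ logB] : \forall N \near \oo,
    (((\sum_(0 <= n < N) w n * (t n - s n) `^ beta) / ln N%:R)%R%:E <= 1%:E)%E.
  by apply: limf_esup_lt; rewrite -/(limn_esup _) log0 lte_fin.
pose e := (beta' - beta) / 2; have e0 : 0 < e by rewrite divr_gt0 ?subr_gt0.
have b1b' : beta + e < beta' by rewrite /e; lra.
apply: (scaled_limsup_shift b1b').
pose G := c1 `^ (- beta) + c2 `^ (- beta).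
have G0 : 0 <= G by rewrite addr_ge0// powR_ge0.
pose E := 2 / c1 + 1; have E0 : 0 < E by rewrite addr_gt0// divr_gt0.
apply: (@le_lt_trans _ _ (C * G * (E `^ e / e))%:E); last exact: ltry.
(* For r <= d, the index bound N chosen below is at least N0, where the
   logarithmic bound applies, and at least 2, where ln N > 0. *)
pose d := 2 / c1 / (N0 + 2)%:R.
have d0 : 0 < d by rewrite divr_gt0 ?divr_gt0// ltr0n addn2.
apply: limf_esup_le; near=> r.
have rpos : 0 < r by near: r; exact: nbhs_right_gt.
have rr0 : r <= r0 by near: r; exact: nbhs_right_le.
have rd : r <= d by near: r; exact: nbhs_right_le.
have r1 : r <= 1 by near: r; exact: nbhs_right_le.
pose N := (Num.truncn (2 / (c1 * r))).+1.
have cr0 : 0 < c1 * r by exact: mulr_gt0.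
have q0 : 0 <= 2 / (c1 * r) by rewrite divr_ge0// ltW.
have Nlo : 2 / (c1 * r) < N%:R by exact: truncnS_gt.
have Nhi : N%:R <= E / r.
  rewrite -natr1; apply: (@le_trans _ _ (2 / (c1 * r) + 1)).
    by rewrite lerD2r truncn_le.
  have -> : 2 / (c1 * r) = 2 / c1 / r by rewrite invfM mulrA.
  by rewrite /E (mulrDl (2 / c1) 1) lerD2l mul1r invf_ge1.
have NN0 : (N0 + 2 <= N)%N.
  rewrite -(ler_nat R); apply: le_trans (ltW Nlo).
  move: rd; rewrite /d ler_pdivlMr ?ltr0n ?addn2// => rd.
  by rewrite invfM mulrA ler_pdivlMr// mulrC.
have short n : c1 * r <= t n - s n -> (n < N)%N.
  move=> len; rewrite -(ltr_nat R); apply: le_lt_trans Nlo.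
  apply: (le_trans (gap_index_bound n hI)).
  by rewrite ler_pM2l// lef_pV2 ?posrE//; apply: lt_le_trans len.
apply: (@le_trans _ _ ((r `^ (beta + e))%:E *
    (C * \sum_(0 <= n < N | c1 * r <= t n - s n <= c2 * r) w n)%:E)%E).
  by apply: lee_wpmul2l; [rewrite lee_fin powR_ge0 | exact: SC].
rewrite -EFinM lee_fin.
rewrite (_ : beta + e = e + beta); last by rewrite addrC.
rewrite powRD ?(gt_eqF rpos) ?implybT//.
have lnN : 0 < ln N%:R :> R by rewrite ln_gt0// ltr1n; exact: leq_trans (leq_addl N0 2) NN0.
have sumB : r `^ beta * \sum_(0 <= n < N | c1 * r <= t n - s n <= c2 * r) w n <=
    G * ln N%:R.
  apply: (@le_trans _ _ (G * \sum_(0 <= n < N) w n * (t n - s n) `^ beta)).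
    rewrite !mulr_sumr big_mkcond/=; apply: ler_sum => n _.
    case: ifPn => [/andP[lo hi]|_]; last by rewrite mulr_ge0// mulr_ge0// powR_ge0.
    rewrite mulrC mulrCA ler_wpM2l//; exact: powR_comparable.
  rewrite ler_wpM2l//.
  have := logB N (leq_trans (leq_addr _ _) NN0).
  by rewrite lee_fin ler_pdivrMr// mul1r.
have lnB : r `^ e * ln N%:R <= E `^ e / e.
  apply: (@le_trans _ _ (r `^ e * (N%:R `^ e / e))).
    by rewrite ler_wpM2l ?powR_ge0// ln_le_powR.
  rewrite mulrA; apply: ler_wpM2r; first by rewrite invr_ge0 ltW.
  rewrite -(powRM _ (ltW rpos) (ler0n _ _)).
  apply: (ge0_ler_powR (ltW e0)).
  - by rewrite nnegrE mulr_ge0// ltW.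
  - by rewrite nnegrE ltW.
  - by rewrite mulrC -ler_pdivlMr.
have := ler_wpM2l (powR_ge0 r e) sumB.
have := ler_wpM2l G0 lnB.
move=> /(ler_wpM2l C0) h1 /(ler_wpM2l C0) h2.
lra.
Unshelve. all: by end_near. Qed.

(** With r = r0 / 2^k, the gaps with r / 2 < l_n <= r contribute at most
    C S(c r) r^beta' up to a constant, hence a constant times theta^k with
    theta = 2^-(beta' - beta) < 1.  Only finitely many gaps are longer than
    r0. *)
Lemma gap_sum_of_moment (R : realType) (F : set R) (s t : nat -> R)
    (mu : probability (measurableTypeR R) R) (a b q beta beta' : R) :
  complementary_intervals F s t -> msupport mu = F -> 0 < a -> 0 < b ->
  beta < beta' -> scaled_limsup mu b q beta = 0%E ->
  (\sum_(0 <= n <oo)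
     (mass_pow mu (enlarge a (s n) (t n)) q * (t n - s n) `^ beta')%:E
   < +oo)%E.
Proof.
move=> hI supp a0 b0 bb' lim0; have [st _ _ _] := hI.
pose w n := mass_pow mu (enlarge a (s n) (t n)) q.
pose v n := w n * (t n - s n) `^ beta'.
have w0 n : 0 <= w n by exact: powR_ge0.
have v0 n : 0 <= v n by rewrite mulr_ge0// powR_ge0.
have [C [c [[C0 c0] CS]]] := gaps_le_partition_sum q hI supp a0 b0.
have [d d0 dB] : exists2 d : R, 0 < d & forall r, 0 < r -> r < d ->
    ((r `^ beta)%:E * partition_sum mu b q r <= 1%:E)%E.
  have lim1 : (scaled_limsup mu b q beta < 1%:E)%E by rewrite lim0 lte_fin.
  exact: near_right0P (limf_esup_lt _ lim1).
pose r0 := d / (2 * c); have r00 : 0 < r0 by rewrite divr_gt0// mulr_gt0.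
have cr0d : c * r0 < d.
  by rewrite (_ : c * r0 = d / 2) /r0; [lra | field; rewrite gt_eqF].
pose G := 1 `^ (- beta') + 2 `^ (- beta').
pose e := beta' - beta; have e0 : 0 < e by rewrite subr_gt0.
pose theta : R := 2^-1 `^ e.
have theta0 : 0 <= theta by exact: powR_ge0.
have theta1 : theta < 1.
  have one : 1 `^ e = 1 :> R by rewrite powR1.
  rewrite -[ltRHS]one.
  by apply: gt0_ltr_powR; rewrite ?nnegrE// invf_lt1// ltr1n.
pose H := G * C * c `^ (- beta) * r0 `^ e.
have G0 : 0 <= G by rewrite addr_ge0// powR_ge0.
have H0 : 0 <= H by rewrite !mulr_ge0// powR_ge0.
have block k N :
    \sum_(0 <= n < N | r0 / 2 ^+ k.+1 < t n - s n <= r0 / 2 ^+ k) v n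
      <= H * theta ^+ k.
  pose r := r0 / 2 ^+ k.
  have rpos : 0 < r by rewrite divr_gt0// exprn_gt0.
  have -> : r0 / 2 ^+ k.+1 = r / 2 by rewrite /r exprSr invfM mulrA.
  rewrite -/r; have crpos : 0 < c * r by rewrite mulr_gt0.
  have crd : c * r < d.
    apply: le_lt_trans cr0d; rewrite ler_pM2l// /r ler_pdivrMr ?exprn_gt0//.
    by rewrite ler_peMr ?(ltW r00)// exprn_ege1// ler1n.
  have massB : (c * r) `^ beta *
      \sum_(0 <= n < N | r / 2 < t n - s n <= r) w n <= C.
    rewrite -lee_fin EFinM.
    apply: (@le_trans _ _
      (((c * r) `^ beta)%:E * (C%:E * partition_sum mu b q (c * r)))%E).
      by apply: lee_wpmul2l (CS r N rpos); rewrite lee_fin powR_ge0.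
    rewrite muleCA -[leRHS]mule1; apply: lee_wpmul2l; first by rewrite lee_fin.
    exact: dB.
  have weighB : \sum_(0 <= n < N | r / 2 < t n - s n <= r) v n <=
      G * r `^ beta' * \sum_(0 <= n < N | r / 2 < t n - s n <= r) w n.
    rewrite mulr_sumr; apply: ler_sum => n /andP[lo hi].
    rewrite /v mulrC ler_wpM2r//; apply: powR_comparable; rewrite ?mul1r//.
      by rewrite subr_gt0.
    by rewrite -ler_pdivrMl// mulrC ltW.
  apply: (le_trans weighB).
  have cr_inv : (c * r) `^ (- beta) * (c * r) `^ beta = 1.
    by rewrite powRN mulVf// powR_eq0 (gt_eqF crpos).
  have rE : r `^ beta' * (c * r) `^ (- beta) =
      c `^ (- beta) * r0 `^ e * theta ^+ k.
    rewrite (powRM _ (ltW c0) (ltW rpos)) mulrCA -powRD; last first.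
      by rewrite (gt_eqF rpos) implybT.
    rewrite -/e /r powRM ?invr_ge0 ?exprn_ge0 ?(ltW r00)// mulrA; congr (_ * _).
    rewrite -[RHS](powR_mulrn _ theta0) /theta -powRrM [e * _]mulrC powRrM.
    by rewrite powR_mulrn ?invr_ge0// exprVn.
  have -> : H * theta ^+ k = G * (r `^ beta' * (c * r) `^ (- beta)) * C.
    by rewrite rE /H; ring.
  have := ler_wpM2l (mulr_ge0 (mulr_ge0 G0 (powR_ge0 r beta'))
    (powR_ge0 (c * r) (- beta))) massB.
  by rewrite [in leLHS]mulrA -[in leLHS](mulrA (G * _)) cr_inv mulr1 (mulrA G).
(* Multiplying by 1 - theta gives the geometric sum in closed form, which makes
   the induction on the number of dyadic layers immediate. *)
have layers K N : (1 - theta) * \sum_(0 <= n < N | r0 / 2 ^+ K < t n - s n <= r0) v n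
    <= H * (1 - theta ^+ K).
  elim: K => [|K IH].
    rewrite expr0 divr1 big1 ?mulr0 ?subrr ?mulr0// => n /andP[lo hi].
    by have := lt_le_trans lo hi; rewrite ltxx.
  have split : \sum_(0 <= n < N | r0 / 2 ^+ K.+1 < t n - s n <= r0) v n <=
      \sum_(0 <= n < N | r0 / 2 ^+ K < t n - s n <= r0) v n +
      \sum_(0 <= n < N | r0 / 2 ^+ K.+1 < t n - s n <= r0 / 2 ^+ K) v n.
    rewrite big_mkcond/= [X in _ <= X + _]big_mkcond/= [X in _ <= _ + X]big_mkcond/=.
    rewrite -big_split/=; apply: ler_sum => n _.
    by move: (v0 n); case: (lerP (t n - s n) (r0 / 2 ^+ K)) => _ vn0;
      case: (r0 / 2 ^+ K.+1 < _); case: (_ <= r0) => /=;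
      rewrite ?add0r ?addr0.
  have th0 : 0 <= 1 - theta by rewrite subr_ge0 ltW.
  have := ler_wpM2l th0 split; have := ler_wpM2l th0 (block K N).
  rewrite (exprS theta).
  by lra.
pose n0 := (Num.truncn (2 / r0)).+1.
have tail n : (n0 <= n)%N -> t n - s n <= r0.
  move=> n0n; rewrite leNgt; apply/negP => big.
  have : n%:R < n%:R :> R.
    apply: (@lt_le_trans _ _ n0%:R); last by rewrite ler_nat.
    apply: le_lt_trans (truncnS_gt (2 / r0)).
    apply: (le_trans (gap_index_bound n hI)).
    by rewrite ler_pM2l// lef_pV2 ?posrE ?subr_gt0// ltW.
  by rewrite ltxx.
have partial N : \sum_(n0 <= n < N) v n <= H / (1 - theta).
  have lN : 0 < t N - s N by rewrite subr_gt0.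
  have quo0 : 0 <= r0 / (t N - s N) by rewrite divr_ge0// ltW.
  pose K := Num.bound (r0 / (t N - s N)).
  have K2 : r0 / (t N - s N) < 2 ^+ K by exact: upper_nthrootP.
  have Klow : r0 / 2 ^+ K < t N - s N.
    by rewrite ltr_pdivrMr ?exprn_gt0// mulrC -ltr_pdivrMr.
  rewrite ler_pdivlMr ?subr_gt0// mulrC.
  apply: (@le_trans _ _ (H * (1 - theta ^+ K))); last first.
    by rewrite ler_piMr// lerBlDr lerDl exprn_ge0.
  apply: le_trans (layers K N); apply: ler_wpM2l; first by rewrite subr_ge0 ltW.
  rewrite (big_nat_widenl n0 0)//= big_mkcond/= [leRHS]big_mkcond/=.
  apply: ler_sum_nat => n /andP[_ nN]; case: (leqP n0 n) => [n0n|_].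
    have lNn := gaps_nonincreasing hI (ltnW nN).
    by rewrite tail// (lt_le_trans Klow lNn).
  by case: ifP.
rewrite (@nneseries_split _ _ 0 n0)//; last first.
  by move=> k _; rewrite lee_fin; exact: v0.
rewrite add0n; apply: (@le_lt_trans _ _
  ((\sum_(0 <= n < n0) v n)%:E + (H / (1 - theta))%:E)%E); last first.
  by rewrite -EFinD ltry.
rewrite -sumEFin; apply: leeD2l; apply: lime_le.
  by apply: is_cvg_nneseries => n _ _; rewrite lee_fin; exact: v0.
by near=> N; rewrite sumEFin lee_fin; exact: partial.
Unshelve. all: by end_near. Qed.

Lemma log_average_of_summable (R : realType) (v : nat -> R) :
  (forall n, 0 <= v n) -> (\sum_(0 <= n <oo) (v n)%:E < +oo)%E ->
  limn_esup (fun N : nat => ((\sum_(0 <= n < N) v n) / ln N%:R)%:E) = 0%E.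
Proof.
move=> v0 fin.
have v0E n : (0 <= (v n)%:E)%E by rewrite lee_fin.
have [M M0 sumM] : exists2 M, 0 < M & forall N, \sum_(0 <= n < N) v n <= M.
  have S0 : (0 <= \sum_(0 <= n <oo) (v n)%:E)%E by apply: nneseries_ge0.
  exists (fine (\sum_(0 <= n <oo) (v n)%:E) + 1).
    by rewrite ltr_wpDl// fine_ge0.
  move=> N; apply: (@le_trans _ _ (fine (\sum_(0 <= n <oo) (v n)%:E)));
    last by rewrite lerDl.
  rewrite -lee_fin fineK ?ge0_fin_numE// -sumEFin.
  exact: nneseries_lim_ge.
have sum0 N : 0 <= \sum_(0 <= n < N) v n by exact: sumr_ge0.
have ln0 N : 0 <= ln N%:R :> R.
  by case: N => [|N]; [rewrite ln0 | rewrite ln_ge0// ler1n].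
apply/eqP; rewrite eq_le; apply/andP; split.
  apply/lee_addgt0Pr => e e0; rewrite add0e; apply: limf_esup_le.
  near=> N; rewrite lee_fin.
  have big : expR (M / e) < N%:R by near: N; exact: nbhs_infty_gtr.
  have N0 : 0 < N%:R :> R := lt_trans (expR_gt0 _) big.
  have : M / e <= ln N%:R.
    by rewrite -(expRK (M / e)) ler_ln ?posrE ?expR_gt0// ltW.
  rewrite ler_pdivrMr// => Me.
  have lnpos : 0 < ln N%:R :> R by rewrite -(pmulr_lgt0 _ e0); exact: lt_le_trans Me.
  by rewrite ler_pdivrMr// mulrC; apply: le_trans (sumM N) Me.
apply: le_ereal_inf_tmp => _ [V /= V0 <-].
have [N VN] : V !=set0 by apply: (filter_ex V0).
apply: (@le_trans _ _ (((\sum_(0 <= n < N) v n) / ln N%:R)%:E)).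
  by rewrite lee_fin divr_ge0.
by apply: ereal_sup_ubound; exists N.
Unshelve. all: by end_near. Qed.

Theorem proposition4 (R : realType) (F : set R) (s t : nat -> R) (lam : R)
    (mu : probability (measurableTypeR R) R) (a b q : R)
    (hF : fractal_set F) (hI : complementary_intervals F s t)
    (hlam0 : 0 < lam) (hlam1 : lam <= 1) (hlac : lacunary F s t lam)
    (hatom : forall x : R, mu [set x] = 0%E) (hsupp : msupport mu = F)
    (ha : 2 / lam <= a) (hb : 0 < b) :
  moment_function mu b q =
    ereal_inf [set beta%:E | beta in [set beta : R |
      (\sum_(0 <= n <oo)
         (mass_pow mu (enlarge a (s n) (t n)) q * (t n - s n) `^ beta)%:E
       < +oo)%E]]
  /\
  moment_function mu b q =
    ereal_inf [set beta%:E | beta in [set beta : R |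
      limn_esup (fun N : nat =>
        ((\sum_(0 <= n < N)
            mass_pow mu (enlarge a (s n) (t n)) q * (t n - s n) `^ beta)
         / ln N%:R)%:E) = 0%E]].
Proof.
have a0 : 0 < a by apply: lt_le_trans ha; rewrite divr_gt0.
pose v beta n := mass_pow mu (enlarge a (s n) (t n)) q * (t n - s n) `^ beta.
set summable := (X in _ = ereal_inf [set _ | _ in X] /\ _).
set logsmall := (X in _ /\ _ = ereal_inf [set _ | _ in X]).
have sum_le : (ereal_inf [set x%:E | x in summable] <= moment_function mu b q)%E.
  apply: ereal_inf_le_shift => beta beta' lim0 bb'.
  exact: gap_sum_of_moment hI hsupp a0 hb bb' lim0.
have log_le : (ereal_inf [set x%:E | x in logsmall] <=
    ereal_inf [set x%:E | x in summable])%E.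
  apply: ereal_inf_le_tmp; apply: image_subset => beta sumbeta.
  apply: log_average_of_summable sumbeta => n.
  by rewrite mulr_ge0// powR_ge0.
have moment_le : (moment_function mu b q <=
    ereal_inf [set x%:E | x in logsmall])%E.
  apply: ereal_inf_le_shift => beta beta' logbeta bb'.
  exact: moment_shift_of_log hI hlam0 hlam1 hlac hsupp ha hb bb' logbeta.
by split; apply/eqP; rewrite eq_le ?moment_le ?sum_le ?andbT
  ?(le_trans log_le)// (le_trans moment_le).
Qed.
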